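(* Suppose that $A\in\mathbb{DC}^{m\times n}$ has singular value decomposition $A=\sum_{j=1}^r\mu_j\mathbf u_j\mathbf v_j^*$, with $\mu_1\ge\mu_2\ge\cdots\ge\mu_r$. If $k\le r$, then the matrix $A_k=\sum_{j=1}^k\mu_j\mathbf u_j\mathbf v_j^*$ satisfies $$\|A-A_k\|_F\le\|A-B\|_F$$ for any $B\in\mathbb{DC}^{m\times n}$ with rank at most $k$.
   Context: Let $\epsilon\neq 0$ be the infinitesimal unit, $\epsilon^2=0$, commuting with complex numbers. Dual complex numbers: $\mathbb{DC}=\{q=q_{st}+q_{\mathcal I}\epsilon : q_{st},q_{\mathcal I}\in\mathbb C\}$ (a commutative ring); dual numbers: $\mathbb D=\{q_{st}+q_{\mathcal I}\epsilon: q_{st},q_{\mathcal I}\in\mathbb R\}$. A number is appreciable if $q_{st}\neq0$ and infinitesimal otherwise. $\mathbb D$ is totally ordered: $p\le q$ iff $p_{st}<q_{st}$, or $p_{st}=q_{st}$ and $p_{\mathcal I}\le q_{\mathcal I}$. The conjugate of $q$ is $\bar q=\bar q_{st}+\bar q_{\mathcal I}\epsilon$; for a matrix $A=(a_{ij})=A_{st}+A_{\mathcal I}\epsilon$ over $\mathbb{DC}$, $A^*=(\bar a_{ji})$. A square matrix $U\in\mathbb{DC}^{n\times n}$ is unitary if $U^*U=I_n$. Singular value decomposition and rank: for every $A\in\mathbb{DC}^{m\times n}$ there are unitary $U\in\mathbb{DC}^{m\times m}$, $V\in\mathbb{DC}^{n\times n}$ such that $U^*AV=\begin{bmatrix}\Sigma&O\\O&O\end{bmatrix}$,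 where $\Sigma=\mathrm{diag}(\mu_1,\dots,\mu_r)$ with positive dual numbers $\mu_1\ge\cdots\ge\mu_r>0$ (appreciable or infinitesimal); $\Sigma$ is uniquely determined by $A$, and the number $r$ of its diagonal entries is the rank of $A$. Writing $\mathbf u_j,\mathbf v_j$ for the $j$th columns of $U,V$, this reads $A=\sum_{j=1}^r\mu_j\mathbf u_j\mathbf v_j^*$. For $q\in\mathbb D$ with $q_{st}>0$, $\sqrt q=\sqrt{q_{st}}+\frac{q_{\mathcal I}}{2\sqrt{q_{st}}}\epsilon$; also $\sqrt0=0$. The magnitude of $q\in\mathbb{DC}$, with $q_{st}=q_1+q_2\mathbf i$, $q_{\mathcal I}=q_3+q_4\mathbf i$, is the dual number $|q|=\sqrt{q_1^2+q_2^2}+\frac{q_1q_3+q_2q_4}{\sqrt{q_1^2+q_2^2}}\epsilon$ if $q_{st}\ne0$, and $|q|=\sqrt{q_3^2+q_4^2}\,\epsilon$ if $q_{st}=0$. The Frobenius norm of $A\in\mathbb{DC}^{m\times n}$ is the dual number $\|A\|_F=\sqrt{\sum_{i,j}|a_{ij}|^2}$ if $A_{st}\neq O$, and $\|A\|_F=\|A_{\mathcal I}\|_F\,\epsilon$ (usual complex Frobenius norm of $A_{\mathcal I}$) if $A_{st}=O$. *)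

(* Defs.v *)
From HB Require Import structures.
From mathcomp Require Import all_boot all_order all_algebra.
From mathcomp Require Import reals complex.

Set Implicit Arguments.
Unset Strict Implicit.
Unset Printing Implicit Defensive.

Import Order.TTheory GRing.Theory Num.Theory.

Local Open Scope ring_scope.
Local Open Scope complex_scope.

(* [DualNum a b] is a + b * epsilon with epsilon ^ 2 = 0; the coefficients are
   real for the dual numbers and complex for the dual complex numbers. *)
Record dual_num (K : Type) : Type := DualNum { dst : K; dinf : K }.

Section DualPair.
Variable K : Type.
Definition pair_of_dual (x : dual_num K) := (dst x, dinf x).
Definition dual_of_pair (p : K * K) := DualNum p.1 p.2.
Lemma pair_of_dualK : cancel pair_of_dual dual_of_pair.
Proof. by case. Qed.
End DualPair.

HB.instance Definition _ (K : eqType) :=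
  Equality.copy (dual_num K) (can_type (@pair_of_dualK K)).
HB.instance Definition _ (K : choiceType) :=
  Choice.copy (dual_num K) (can_type (@pair_of_dualK K)).

Section DualRing.
Variable K : comNzRingType.
Implicit Types x y z : dual_num K.

Definition dual_zero : dual_num K := DualNum 0 0.
Definition dual_one : dual_num K := DualNum 1 0.
Definition dual_opp x := DualNum (- dst x) (- dinf x).
Definition dual_add x y := DualNum (dst x + dst y) (dinf x + dinf y).
Definition dual_mul x y :=
  DualNum (dst x * dst y) (dst x * dinf y + dinf x * dst y).

Fact dual_addA : associative dual_add.
Proof. by move=> x y z; rewrite /dual_add /= !addrA. Qed.
Fact dual_addC : commutative dual_add.
Proof. by move=> x y; rewrite /dual_add addrC [dinf x + _]addrC. Qed.
Fact dual_add0 : left_id dual_zero dual_add.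
Proof. by case=> a b; rewrite /dual_add /= !add0r. Qed.
Fact dual_addN : left_inverse dual_zero dual_opp dual_add.
Proof. by move=> x; rewrite /dual_add /= !addNr. Qed.

HB.instance Definition _ := GRing.isZmodule.Build (dual_num K)
  dual_addA dual_addC dual_add0 dual_addN.

Fact dual_mulA : associative dual_mul.
Proof.
by move=> x y z; rewrite /dual_mul /= !mulrDr !mulrDl !mulrA !addrA.
Qed.
Fact dual_mulC : commutative dual_mul.
Proof.
move=> x y; rewrite /dual_mul [dst x * dst y]mulrC addrC.
by rewrite [dinf x * _]mulrC [dst x * _]mulrC.
Qed.
Fact dual_mul1 : left_id dual_one dual_mul.
Proof. by case=> a b; rewrite /dual_mul /= !mul1r mul0r addr0. Qed.
Fact dual_mulDl : left_distributive dual_mul +%R.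
Proof.
move=> x y z; rewrite /dual_mul /=.
by congr DualNum; rewrite /= !mulrDl // addrACA.
Qed.
Fact dual_one_neq0 : dual_one != 0.
Proof. by apply/eqP => -[] /eqP; rewrite oner_eq0. Qed.

HB.instance Definition _ := GRing.Zmodule_isComNzRing.Build (dual_num K)
  dual_mulA dual_mulC dual_mul1 dual_mulDl dual_one_neq0.

End DualRing.

Section DualOrder.
Variable R : realDomainType.
Implicit Types p q : dual_num R.

Definition dual_le p q : bool :=
  (dst p < dst q) || (dst p == dst q) && (dinf p <= dinf q).

Fact dual_le_refl : reflexive dual_le.
Proof. by move=> p; rewrite /dual_le eqxx lexx orbT. Qed.
Fact dual_le_anti : antisymmetric dual_le.
Proof.
case=> a b [c d]; rewrite /dual_le /=.
case: (ltgtP a c) => [//|//|->] /= bd.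
by congr DualNum; apply: le_anti.
Qed.
Fact dual_le_trans : transitive dual_le.
Proof.
move=> [c d] [a b] [e f]; rewrite /dual_le /=.
case/orP=> [ac|/andP[/eqP-> bd]]; case/orP=> [ce|/andP[/eqP<- df]].
- by rewrite (lt_trans ac ce).
- by rewrite ac.
- by rewrite ce.
- by rewrite eqxx (le_trans bd df) orbT.
Qed.

HB.instance Definition _ := Order.Le_isPOrder.Build ring_display (dual_num R)
  dual_le_refl dual_le_anti dual_le_trans.

Fact dual_le_total : total (<=%O : rel (dual_num R)).
Proof.
by case=> a b [c d]; rewrite /Order.le /= /dual_le /=; case: ltgtP => //= _;
  apply: le_total.
Qed.

HB.instance Definition _ :=
  Order.POrder_isTotal.Build ring_display (dual_num R) dual_le_total.

End DualOrder.

Section DualComplexMatrices.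
Variable R : realType.
Local Notation D := (dual_num R).
Local Notation DC := (dual_num R[i]).

Definition dual_complex (q : D) : DC := DualNum (dst q)%:C (dinf q)%:C.

Definition dual_conj (q : DC) : DC :=
  DualNum (conjc (dst q)) (conjc (dinf q)).

(* Meaningful for q = 0 and for dst q > 0. Since Num.sqrt 0 = 0 and 0^-1 = 0,
   the formula does give dual_sqrt 0 = 0. *)
Definition dual_sqrt (q : D) : D :=
  DualNum (Num.sqrt (dst q)) (dinf q / (2 * Num.sqrt (dst q))).

Definition dual_abs (q : DC) : D :=
  let: q1 +i* q2 := dst q in
  let: q3 +i* q4 := dinf q in
  if dst q != 0 then
    DualNum (Num.sqrt (q1 ^+ 2 + q2 ^+ 2))
            ((q1 * q3 + q2 * q4) / Num.sqrt (q1 ^+ 2 + q2 ^+ 2))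
  else DualNum 0 (Num.sqrt (q3 ^+ 2 + q4 ^+ 2)).

Definition complex_frobenius m n (M : 'M[R[i]]_(m, n)) : R :=
  Num.sqrt (\sum_i \sum_j (complex.Re (M i j) ^+ 2 + complex.Im (M i j) ^+ 2)).

Definition mx_st m n (A : 'M[DC]_(m, n)) : 'M[R[i]]_(m, n) := map_mx (@dst _) A.
Definition mx_inf m n (A : 'M[DC]_(m, n)) : 'M[R[i]]_(m, n) :=
  map_mx (@dinf _) A.

Definition dual_frobenius m n (A : 'M[DC]_(m, n)) : D :=
  if mx_st A != 0 then dual_sqrt (\sum_i \sum_j dual_abs (A i j) ^+ 2)
  else DualNum 0 (complex_frobenius (mx_inf A)).

Definition dual_adjoint m n (A : 'M[DC]_(m, n)) : 'M[DC]_(n, m) :=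
  map_mx dual_conj A^T.

Definition dual_unitary n (U : 'M[DC]_n) : Prop :=
  dual_adjoint U *m U = 1%:M.

(* The m x n matrix with diag(mu) as its leading r x r block and zero blocks
   elsewhere; castmx only identifies r + (m - r) with m and r + (n - r)
   with n. *)
Definition sing_mx m n r (hm : (r <= m)%N) (hn : (r <= n)%N) (mu : 'I_r -> D) :
    'M[DC]_(m, n) :=
  castmx (subnKC hm, subnKC hn)
    (block_mx (diag_mx (\row_i dual_complex (mu i))) 0
              0 0 : 'M[DC]_(r + (m - r), r + (n - r))).

Definition is_svd m n r (hm : (r <= m)%N) (hn : (r <= n)%N)
    (A : 'M[DC]_(m, n)) (U : 'M[DC]_m) (V : 'M[DC]_n) (mu : 'I_r -> D) : Prop :=
  [/\ dual_unitary U, dual_unitary V,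
      forall i, 0 < mu i,
      forall i j : 'I_r, (i <= j)%N -> mu j <= mu i
    & dual_adjoint U *m A *m V = sing_mx hm hn mu].

(* The number of singular values does not depend on the decomposition, so the
   rank is given by its graph. *)
Definition has_rank m n (A : 'M[DC]_(m, n)) (r : nat) : Prop :=
  exists (hm : (r <= m)%N) (hn : (r <= n)%N) U V (mu : 'I_r -> D),
    is_svd hm hn A U V mu.

Definition svd_trunc m n r (hm : (r <= m)%N) (hn : (r <= n)%N)
    (U : 'M[DC]_m) (V : 'M[DC]_n) (mu : 'I_r -> D) (k : nat) :
    'M[DC]_(m, n) :=
  \sum_(j < r | (j < k)%N)
     dual_complex (mu j) *:
       (col (widen_ord hm j) U *m dual_adjoint (col (widen_ord hn j) V)).

End DualComplexMatrices.

(* Main.v *)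
From HB Require Import structures.
Require Import Defs.
From mathcomp Require Import all_boot all_order all_algebra.
From mathcomp Require Import reals complex polyrcf ring lra.

Set Implicit Arguments.
Unset Strict Implicit.
Unset Printing Implicit Defensive.

Import Order.TTheory GRing.Theory Num.Theory.

Local Open Scope ring_scope.
Local Open Scope complex_scope.

(** The dual order is the order of germs at t = 0+: p <= q in the dual numbers
    exactly when p_st + t p_I <= q_st + t q_I for all small real t > 0. The
    theorem follows from the Eckart-Young theorem over the complex numbers by
    replacing epsilon with such a t.

    The dual Frobenius norm is invariant under dual unitary matrices
    ([dual_frobenius_unitary]), so A may be taken to be the rectangular
    diagonal matrix of its singular values and B to be a product X Y with inner
    dimension s <= k. For small t > 0 the real numbers mu_j(t) are nonnegative
    and nonincreasing ([dual_at_le_fin]), and the complex matrix X(t) Y(t) has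
    rank at most k, so that
      |D(t) - D_k(t)|^2 <= |D(t) - X(t) Y(t)|^2
    by the classical theorem ([eckart_young_rect_diag]). The product X(t) Y(t)
    differs from B_st + t B_I by t^2 X_I Y_I only. Both sides are polynomials
    in t, and the first nonzero coefficient of their difference is therefore
    positive ([poly_first_coef_ge0]). The coefficients of degree 0 and 1 compare
    the standard and infinitesimal parts of the norms; when both standard parts
    vanish, t^2 X_I Y_I no longer contributes in degree 2, whose coefficient
    compares the norms of the infinitesimal parts. This is
    [dual_frobenius_le].

    The classical theorem for a diagonal D is proved by projecting the rows of
    D - G on the orthogonal complement of the row space of G: this bounds
    |D - G|^2 below by the sum of d_j^2 (1 - p_j), where the p_j are diagonal
    entries of an orthogonal projection of rank at most k, hence lie in [0, 1]
    and add up to at most k ([sum_weights_le]). *)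

(** * Rectangular diagonal matrices *)

(** The m x n matrix with diagonal entries d_0, ..., d_(r-1) and zeros
    elsewhere; it has this meaning when r <= m and r <= n. *)
Definition rect_diag (K : pzRingType) m n r (d : 'I_r -> K) : 'M[K]_(m, n) :=
  pid_mx r *m diag_mx (\row_j d j) *m pid_mx r.
Arguments rect_diag {K} m n {r} d.

(** The family d with its first k entries replaced by 0. *)
Definition tail (K : nmodType) r (k : nat) (d : 'I_r -> K) (j : 'I_r) : K :=
  d j *+ (k <= j)%N.

Lemma pid_mx_colsub (K : pzRingType) n r (hn : (r <= n)%N) :
  pid_mx r = colsub (widen_ord hn) 1%:M :> 'M[K]_(n, r).
Proof. by rewrite -pid_mxEcol -[RHS]pid_mx_minh (minn_idPl hn). Qed.

Section RectDiag.
Variable K : pzRingType.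

Lemma rect_diagD m n r (d d' : 'I_r -> K) :
  rect_diag m n d + rect_diag m n d' = rect_diag m n (fun j => d j + d' j).
Proof.
rewrite /rect_diag -mulmxDl -mulmxDr -raddfD; congr (_ *m diag_mx _ *m _).
by apply/rowP => j; rewrite !mxE.
Qed.

Lemma eq_rect_diag m n r (d d' : 'I_r -> K) :
  d =1 d' -> rect_diag m n d = rect_diag m n d'.
Proof.
move=> dd'; rewrite /rect_diag; congr (_ *m diag_mx _ *m _).
by apply/rowP => j; rewrite !mxE.
Qed.

Lemma castmx_rect_diag m m' n n' r (eqm : m = m') (eqn : n = n')
    (d : 'I_r -> K) :
  castmx (eqm, eqn) (rect_diag m n d) = rect_diag m' n' d.
Proof. by case: _ / eqm; case: _ / eqn; rewrite castmx_id. Qed.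

Lemma rect_diag_block m n r (d : 'I_r -> K) :
  rect_diag (r + m) (r + n) d = block_mx (diag_mx (\row_j d j)) 0 0 0.
Proof.
rewrite /rect_diag pid_mx_col pid_mx_row mul_col_mx mul1mx mul0mx mul_col_row.
by rewrite !mulmx1 !mulmx0.
Qed.
End RectDiag.

Lemma rect_diagZ (K : comPzRingType) m n r (a : K) (d : 'I_r -> K) :
  a *: rect_diag m n d = rect_diag m n (fun j => a * d j).
Proof.
rewrite /rect_diag scalemxAl scalemxAr -linearZ; congr (_ *m diag_mx _ *m _).
by apply/rowP => j; rewrite !mxE.
Qed.

(** * The Eckart-Young theorem for diagonal complex matrices *)

(** A weighted sum with coefficients in [0, 1] of total at most #|A| is largest
    when the coefficients are concentrated on the #|A| largest weights; the
    nonnegative threshold c separates these weights from the others. *)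
Lemma sum_weights_le (K : numDomainType) (I : finType) (A : pred I)
    (w p : I -> K) (c : K) :
    0 <= c -> (forall i, A i -> c <= w i) -> (forall i, ~~ A i -> w i <= c) ->
    (forall i, 0 <= p i <= 1) -> \sum_i p i <= #|A|%:R ->
  \sum_i w i * p i <= \sum_(i | A i) w i.
Proof.
move=> c0 wA wNA p01 pA; rewrite [leRHS]big_mkcond /= -subr_ge0 -sumrB.
(* Termwise, ([i in A] - p_i) (w_i - c) >= 0. *)
apply: (@le_trans _ _ (\sum_i c * ((A i)%:R - p i))).
  rewrite -mulr_sumr mulr_ge0 // sumrB subr_ge0 (le_trans pA) //.
  by rewrite -natr_sum -sum1_card big_mkcond.
apply: ler_sum => i _; rewrite -subr_ge0.
have /andP[p0 p1] := p01 i.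
case: ifPn => Ai /=.
  have -> : w i - w i * p i - c * (1 - p i) = (w i - c) * (1 - p i).
    by ring.
  by rewrite mulr_ge0 // subr_ge0 // wA.
have -> : 0 - w i * p i - c * (0 - p i) = (c - w i) * p i by ring.
by rewrite mulr_ge0 // subr_ge0 wNA.
Qed.

Section EckartYoung.
Variable C : numClosedFieldType.
Local Open Scope sesquilinear_scope.

Lemma trmxC_mul m n p (X : 'M[C]_(m, n)) (Y : 'M[C]_(n, p)) :
  (X *m Y)^t* = Y^t* *m X^t*.
Proof. by rewrite trmx_mul map_mxM. Qed.

Lemma mxtrace_adj m n (X : 'M[C]_(m, n)) :
  \tr (X *m X^t*) = \sum_i \sum_j `|X i j| ^+ 2.
Proof.
apply: eq_bigr => i _; rewrite !mxE; apply: eq_bigr => j _.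
by rewrite !mxE normCK.
Qed.

Lemma mxtrace_adj_ge0 m n (X : 'M[C]_(m, n)) : 0 <= \tr (X *m X^t*).
Proof.
by rewrite mxtrace_adj; do 2![apply: sumr_ge0 => ? _]; rewrite exprn_ge0.
Qed.

Lemma mxtrace_rect_diag m n r (hm : (r <= m)%N) (hn : (r <= n)%N)
    (d : 'I_r -> C) (M : 'M[C]_n) :
  \tr (rect_diag m n d *m M *m (rect_diag m n d)^t*) =
  \sum_j `|d j| ^+ 2 * M (widen_ord hn j) (widen_ord hn j).
Proof.
rewrite /rect_diag !trmxC_mul !tr_pid_mx !map_pid_mx.
rewrite !mulmxA mxtrace_mulC !mulmxA pid_mx_id // pid_mx_1 mul1mx.
rewrite tr_diag_mx map_diag_mx.
apply: eq_bigr => j _.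
rewrite mul_mx_diag mxE.
rewrite (pid_mxErow _ hn) (pid_mx_colsub _ hn).
rewrite mulmx_colsub mulmx1 -mulmxA mul_rowsub_mx.
by rewrite mul_diag_mx mul1mx !mxE normCK mulrAC.
Qed.

(** The rows of W are an orthonormal basis of the row space of G. *)
Lemma rank_factor m n (G : 'M[C]_(m, n)) :
  exists (Z : 'M[C]_(m, \rank G)) (W : 'M[C]_(\rank G, n)),
    W *m W^t* = 1%:M /\ G = Z *m W.
Proof.
have le_rn : (\rank G <= n)%N by exact: rank_leq_col.
pose W := schmidt (row_base G).
have GW : (G <= W)%MS by rewrite -(eq_row_base G) schmidt_sub.
exists (G *m pinvmx W), W; split; last by rewrite mulmxKpV.
exact/unitarymxP/schmidt_unitarymx.
Qed.

(** Eckart-Young theorem for a rectangular diagonal matrix. *)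
Lemma eckart_young_rect_diag m n r k (hm : (r <= m)%N) (hn : (r <= n)%N)
    (d : 'I_r -> C) (G : 'M[C]_(m, n)) :
    (k <= r)%N -> (forall j, 0 <= d j) ->
    (forall i j : 'I_r, (i <= j)%N -> d j <= d i) -> (\rank G <= k)%N ->
  \sum_i \sum_j `|rect_diag m n (tail k d) i j| ^+ 2 <=
  \sum_i \sum_j `|(rect_diag m n d - G) i j| ^+ 2.
Proof.
move=> kr d0 dS rkG; have [Z [W [WW GE]]] := rank_factor G.
set D := rect_diag m n d; set E := D - G.
(* Q is the orthogonal projection on the complement of the row space of G. *)
pose Q : 'M[C]_n := 1%:M - W^t* *m W.
have QH : Q^t* = Q.
  by rewrite /Q linearB /= map_mxB trmx1 map_mx1 trmxC_mul trmxCK.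
have WQ : W *m Q = 0 by rewrite mulmxBr mulmx1 mulmxA WW mul1mx subrr.
have QQ : Q *m Q = Q by rewrite {1}/Q mulmxBl mul1mx -mulmxA WQ mulmx0 subr0.
have GQ : G *m Q = 0 by rewrite {1}GE -mulmxA WQ mulmx0.
have EQ : E *m Q = D *m Q by rewrite mulmxBl GQ subr0.
have EQE : E *m Q *m E^t* = D *m Q *m D^t*.
  by rewrite -QQ !mulmxA EQ -mulmxA -{2}QH -trmxC_mul EQ trmxC_mul QH !mulmxA.
pose p (j : 'I_r) : C := (W^t* *m W) (widen_ord hn j) (widen_ord hn j).
have splitE : E *m E^t* = (E *m W^t*) *m (E *m W^t*)^t* + D *m Q *m D^t*.
  rewrite -EQE trmxC_mul trmxCK !mulmxA -mulmxDl -mulmxA -mulmxDr.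
  by rewrite addrC subrK mulmx1.
rewrite -!mxtrace_adj -/D -/E splitE mxtraceD -[leLHS]add0r.
apply: lerD; first exact: mxtrace_adj_ge0.
rewrite -[X in X *m _^t*]mulmx1 !(mxtrace_rect_diag hm hn).
have pE i : (W^t* *m W) i i = \sum_l `|W l i| ^+ 2.
  by rewrite mxE; apply: eq_bigr => l _; rewrite !mxE mulrC normCK.
have QE i : Q i i = 1 - (W^t* *m W) i i.
  by rewrite !mxE eqxx.
have p0 i : 0 <= (W^t* *m W) i i.
  by rewrite pE sumr_ge0 // => l _; rewrite exprn_ge0.
have p1 i : (W^t* *m W) i i <= 1.
  rewrite -subr_ge0 -QE -QQ -{2}QH mxE sumr_ge0 // => l _.
  by rewrite !mxE -normCK exprn_ge0.
have sumP : \sum_j p j <= k%:R.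
  apply: (@le_trans _ _ (\tr (W^t* *m W))); last first.
    by rewrite mxtrace_mulC WW mxtrace1 ler_nat.
  rewrite /mxtrace.
  rewrite [leRHS](bigID (fun i : 'I_n => (i < r)%N)) /= -[leLHS]addr0 lerD //.
    rewrite (big_ord_narrow hn) /=; exact: lexx.
  by rewrite sumr_ge0.
have -> : \sum_j `|d j| ^+ 2 * Q (widen_ord hn j) (widen_ord hn j) =
          \sum_j d j ^+ 2 - \sum_j d j ^+ 2 * p j.
  rewrite -sumrB; apply: eq_bigr => j _.
  by rewrite QE mulrBr mulr1 ger0_norm.
have -> : \sum_j `|tail k d j| ^+ 2 * (1%:M : 'M[C]_n) (widen_ord hn j)
    (widen_ord hn j) = \sum_j d j ^+ 2 - \sum_(j < r | (j < k)%N) d j ^+ 2.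
  rewrite [X in _ = _ - X]big_mkcond -sumrB; apply: eq_bigr => j _.
  rewrite mxE eqxx mulr1 /tail ltnNge.
  case: (k <= j)%N; first by rewrite /= mulr1n subr0 (ger0_norm (d0 j)).
  by rewrite mulr0n normr0 expr0n subrr.
rewrite lerD2l lerN2.
have cardA : #|[pred j : 'I_r | (j < k)%N]| = k.
  by rewrite -sum1_card /= (big_ord_narrow kr) sum1_card card_ord.
have dS2 (i j : 'I_r) : (i <= j)%N -> d j ^+ 2 <= d i ^+ 2.
  by move=> ij; rewrite lerXn2r ?nnegrE //; apply: dS.
have p01 j : 0 <= p j <= 1 by rewrite p0 p1.
(* The threshold is d_k ^ 2, or 0 when k = r and there is no d_k. *)
have [c [c0 cA cNA]] : exists c : C, [/\ 0 <= c,
    forall j : 'I_r, (j < k)%N -> c <= d j ^+ 2 &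
    forall j : 'I_r, ~~ (j < k)%N -> d j ^+ 2 <= c].
  case: (ltnP k r) => [kltr | rk].
    exists (d (Ordinal kltr) ^+ 2); split => [|j jk|j jk].
    - by rewrite exprn_ge0.
    - by apply: dS2; apply: ltnW.
    - by apply: dS2; rewrite leqNgt.
  exists 0; split => // j jk; first by rewrite exprn_ge0.
  by rewrite (leq_trans (ltn_ord j) rk) in jk.
apply: (sum_weights_le (A := [pred j : 'I_r | (j < k)%N]) c0 cA cNA p01).
by rewrite cardA.
Qed.
End EckartYoung.

(** * Unitary invariance of the dual Frobenius norm *)

Section DualMorphisms.
Variable K : comNzRingType.

Fact dst_is_additive : additive (@dst K). Proof. by []. Qed.
Fact dst_is_multiplicative : multiplicative (@dst K). Proof. by []. Qed.
Fact dinf_is_additive : additive (@dinf K). Proof. by []. Qed.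

HB.instance Definition _ := GRing.isAdditive.Build (dual_num K) K (@dst K)
  dst_is_additive.
HB.instance Definition _ := GRing.isMultiplicative.Build (dual_num K) K
  (@dst K) dst_is_multiplicative.
HB.instance Definition _ := GRing.isAdditive.Build (dual_num K) K (@dinf K)
  dinf_is_additive.
End DualMorphisms.

Section ComplexDual.
Variable R : realType.
Local Notation C := R[i].
Local Notation D := (dual_num R).
Local Notation DC := (dual_num C).

Fact dual_conj_is_additive : additive (@dual_conj R).
Proof. by move=> x y; congr DualNum; apply: (rmorphB (@conjc R)). Qed.
Fact dual_conj_is_multiplicative : multiplicative (@dual_conj R).
Proof.
split=> [x y|]; last by rewrite /dual_conj /= oppr0.
by congr DualNum; rewrite ?(rmorphD (@conjc R)) !(rmorphM (@conjc R)).
Qed.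
HB.instance Definition _ := GRing.isAdditive.Build DC DC (@dual_conj R)
  dual_conj_is_additive.
HB.instance Definition _ := GRing.isMultiplicative.Build DC DC (@dual_conj R)
  dual_conj_is_multiplicative.

Fact dual_complex_is_additive : additive (@dual_complex R).
Proof. by move=> x y; congr DualNum; apply: (rmorphB (real_complex R)). Qed.
Fact dual_complex_is_multiplicative : multiplicative (@dual_complex R).
Proof.
split=> [x y|] //.
by congr DualNum;
  rewrite ?(rmorphD (real_complex R)) !(rmorphM (real_complex R)).
Qed.
HB.instance Definition _ := GRing.isAdditive.Build D DC (@dual_complex R)
  dual_complex_is_additive.
HB.instance Definition _ := GRing.isMultiplicative.Build D DC (@dual_complex R)
  dual_complex_is_multiplicative.

Lemma dual_complex_inj : injective (@dual_complex R).
Proof. by move=> [a b] [c d] [-> ->]. Qed.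

Lemma dual_adjointM m n p (X : 'M[DC]_(m, n)) (Y : 'M[DC]_(n, p)) :
  dual_adjoint (X *m Y) = dual_adjoint Y *m dual_adjoint X.
Proof. by rewrite /dual_adjoint trmx_mul map_mxM. Qed.

Lemma dual_adjointK m n : cancel (@dual_adjoint R m n) (@dual_adjoint R n m).
Proof.
by move=> X; apply/matrixP => i j; rewrite !mxE; case: (X i j) => a b;
  rewrite /dual_conj /= !conjcK.
Qed.

Lemma mx_stM m n p (X : 'M[DC]_(m, n)) (Y : 'M[DC]_(n, p)) :
  mx_st (X *m Y) = mx_st X *m mx_st Y.
Proof. exact: map_mxM. Qed.

Lemma mx_infM m n p (X : 'M[DC]_(m, n)) (Y : 'M[DC]_(n, p)) :
  mx_inf (X *m Y) = mx_st X *m mx_inf Y + mx_inf X *m mx_st Y.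
Proof.
apply/matrixP => i j; rewrite !mxE raddf_sum -big_split /=.
by apply: eq_bigr => l _; rewrite !mxE.
Qed.

(** The squared Frobenius norm of a complex matrix. *)
Definition frob2 m n (M : 'M[C]_(m, n)) : R :=
  \sum_i \sum_j (complex.Re (M i j) ^+ 2 + complex.Im (M i j) ^+ 2).

(** The real part of the Frobenius inner product of two complex matrices. *)
Definition frob_dot m n (M N : 'M[C]_(m, n)) : R :=
  \sum_i \sum_j (complex.Re (M i j) * complex.Re (N i j) +
                 complex.Im (M i j) * complex.Im (N i j)).

Lemma frob2_ge0 m n (M : 'M[C]_(m, n)) : 0 <= frob2 M.
Proof. by do 2![apply: sumr_ge0 => ? _]; rewrite addr_ge0 ?sqr_ge0. Qed.

Lemma frob2_eq0 m n (M : 'M[C]_(m, n)) : (frob2 M == 0) = (M == 0).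
Proof.
apply/eqP/eqP => [M0|->]; last first.
  by do 2![apply: big1 => ? _]; rewrite mxE /= expr0n addr0.
have sq_ge0 (z : C) : 0 <= complex.Re z ^+ 2 + complex.Im z ^+ 2.
  by rewrite addr_ge0 ?sqr_ge0.
apply/matrixP => i j; rewrite mxE.
have /psumr_eq0P := M0 => /(_ _ i isT) Mi0.
have /psumr_eq0P := Mi0 (fun i _ => sumr_ge0 _ (fun j _ => sq_ge0 _)).
move=> /(_ (fun j _ => sq_ge0 _) j isT) /eqP.
rewrite paddr_eq0 ?sqr_ge0 // !sqrf_eq0.
by case: (M i j) => a b /= /andP[/eqP-> /eqP->].
Qed.

Lemma frob2C m n (M : 'M[C]_(m, n)) :
  (frob2 M)%:C = \sum_i \sum_j `|M i j| ^+ 2.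
Proof.
rewrite rmorph_sum; apply: eq_bigr => i _.
by rewrite rmorph_sum; apply: eq_bigr => j _; exact: add_Re2_Im2.
Qed.

Lemma dual_abs2E (q : DC) :
  dual_abs q ^+ 2 =
  DualNum (complex.Re (dst q) ^+ 2 + complex.Im (dst q) ^+ 2)
          (2 * (complex.Re (dst q) * complex.Re (dinf q) +
                complex.Im (dst q) * complex.Im (dinf q))).
Proof.
case: q => -[a b] [c d]; rewrite /dual_abs /=.
have ab0 : 0 <= a ^+ 2 + b ^+ 2 by rewrite addr_ge0 ?sqr_ge0.
case: ifPn => [nz|/negPn/eqP [-> ->]]; last first.
  by rewrite expr2; congr DualNum => /=; ring.
have s0 : Num.sqrt (a ^+ 2 + b ^+ 2) != 0.
  rewrite sqrtr_eq0 -ltNge lt_def ab0 andbT paddr_eq0 ?sqr_ge0 // !sqrf_eq0.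
  by move: nz; rewrite eq_complex.
rewrite expr2; congr DualNum => /=; first by rewrite -expr2 sqr_sqrtr.
by field.
Qed.

Lemma mul_dual_conj (q : DC) : dual_conj q * q = dual_complex (dual_abs q ^+ 2).
Proof.
rewrite dual_abs2E; case: q => -[a b] [c d].
by congr DualNum; apply/eqP; rewrite eq_complex /=; apply/andP; split;
  apply/eqP; ring.
Qed.

(** The square of the dual Frobenius norm, without any case distinction. *)
Definition dual_frob2 m n (M : 'M[DC]_(m, n)) : D :=
  \sum_i \sum_j dual_abs (M i j) ^+ 2.

Lemma dual_frob2E m n (M : 'M[DC]_(m, n)) :
  dual_frob2 M =
  DualNum (frob2 (mx_st M)) (2 * frob_dot (mx_st M) (mx_inf M)).
Proof.
transitivity (DualNum (dst (dual_frob2 M)) (dinf (dual_frob2 M))).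
  by case: (dual_frob2 M).
congr DualNum; rewrite raddf_sum ?mulr_sumr; apply: eq_bigr => i _;
  rewrite raddf_sum ?mulr_sumr; apply: eq_bigr => j _;
  by rewrite dual_abs2E !mxE.
Qed.

Lemma mxtrace_dual_adjoint m n (M : 'M[DC]_(m, n)) :
  \tr (dual_adjoint M *m M) = dual_complex (dual_frob2 M).
Proof.
rewrite /dual_frob2 exchange_big raddf_sum; apply: eq_bigr => j _.
rewrite mxE raddf_sum; apply: eq_bigr => i _.
by rewrite !mxE mul_dual_conj.
Qed.

Lemma dual_frob2_unitary m n (U : 'M[DC]_m) (V : 'M[DC]_n)
    (M : 'M[DC]_(m, n)) :
  dual_unitary U -> dual_unitary V ->
  dual_frob2 (dual_adjoint U *m M *m V) = dual_frob2 M.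
Proof.
move=> /mulmx1C UU /mulmx1C VV; apply: dual_complex_inj.
rewrite -!mxtrace_dual_adjoint !dual_adjointM dual_adjointK.
rewrite !mulmxA mxtrace_mulC !mulmxA VV mul1mx.
by rewrite -[_ *m U *m _]mulmxA UU mulmx1.
Qed.

Lemma dual_frobenius_unitary m n (U : 'M[DC]_m) (V : 'M[DC]_n)
    (M : 'M[DC]_(m, n)) :
  dual_unitary U -> dual_unitary V ->
  dual_frobenius (dual_adjoint U *m M *m V) = dual_frobenius M.
Proof.
move=> hU hV; rewrite /dual_frobenius.
set N := dual_adjoint U *m M *m V.
have NM : dual_frob2 N = dual_frob2 M by exact: dual_frob2_unitary.
have st0 : (mx_st N == 0) = (mx_st M == 0).
  by rewrite -!frob2_eq0; move: NM; rewrite !dual_frob2E => -[-> _].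
rewrite -/(dual_frob2 N) -/(dual_frob2 M) NM st0.
case: eqP => //= M0; congr DualNum; congr Num.sqrt.
(* An infinitesimal M has the norm of its infinitesimal part seen as the
   standard part of another dual matrix. *)
pose L : 'M[DC]_(m, n) := map_mx (fun z => DualNum z 0) (mx_inf M).
have stL : mx_st L = mx_inf M by apply/matrixP => i j; rewrite !mxE.
have stL' : mx_st (dual_adjoint U *m L *m V) = mx_inf N.
  by rewrite /N !(mx_stM, mx_infM) M0 stL !(mulmx0, mul0mx) !(addr0, add0r).
have := dual_frob2_unitary L hU hV.
by rewrite !dual_frob2E => -[+ _]; rewrite stL stL'.
Qed.

End ComplexDual.

(** * Dual numbers as germs at 0+ *)

(** If a polynomial is nonnegative on the right of 0, then its nonzero
    coefficient of lowest degree is positive; no claim is made that the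
    coefficient of index i is that one, hence the large inequality. *)
Lemma poly_first_coef_ge0 (F : rcfType) (p : {poly F}) (e : F) (i : nat) :
    0 < e -> (forall t, 0 < t < e -> 0 <= p.[t]) ->
    (forall j, (j < i)%N -> p`_j = 0) ->
  0 <= p`_i.
Proof.
move=> e0 p_ge0 p_low.
pose q := drop_poly i p.
have pE : p = q * 'X^i.
  rewrite -[LHS](poly_take_drop i) -/q -[RHS]add0r; congr (_ + _).
  apply/polyP => j; rewrite coef_take_poly coef0.
  by case: ltnP => // /p_low.
have -> : p`_i = q.[0] by rewrite horner_coef0 coef_drop_poly.
rewrite leNgt; apply/negP => q0.
have [d d0 dP] : exists2 d, d > 0 &
    forall y, `|y - 0| < d -> `|q.[y] - q.[0]| < - q.[0].
  by apply: poly_cont; rewrite oppr_gt0.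
pose t := Num.min d e / 2.
have t0 : 0 < t by rewrite divr_gt0 ?lt_min ?d0 ?e0.
have tmin : t < Num.min d e by rewrite gtr_pMr ?invf_lt1 ?ltr1n ?lt_min ?d0 ?e0.
have /andP[td te] : (t < d) && (t < e) by rewrite -lt_min.
have := dP t; rewrite subr0 gtr0_norm // => /(_ td).
rewrite ltr_norml opprK => /andP[_]; rewrite ltrBlDr addNr => qt.
have := p_ge0 t; rewrite t0 te pE hornerM hornerXn pmulr_lge0 ?exprn_gt0 //.
by move=> /(_ isT); rewrite leNgt qt.
Qed.

Section Germs.
Variable R : realType.
Local Notation C := R[i].
Local Notation D := (dual_num R).
Local Notation DC := (dual_num C).

Lemma frob2_expand m n (X Y Z : 'M[C]_(m, n)) (t : R) :
  frob2 (X + t%:C *: Y + (t ^+ 2)%:C *: Z) =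
  frob2 X + t * (2 * frob_dot X Y) + t ^+ 2 * (frob2 Y + 2 * frob_dot X Z) +
  t ^+ 3 * (2 * frob_dot Y Z) + t ^+ 4 * frob2 Z.
Proof.
rewrite /frob2 /frob_dot !mulr_sumr -!big_split /= !mulr_sumr -!big_split /=.
apply: eq_bigr => i _.
rewrite !mulr_sumr -!big_split /= !mulr_sumr -!big_split /=.
apply: eq_bigr => j _; rewrite !mxE.
case: (X i j) (Y i j) (Z i j) => [x x'] [y y'] [z z'] /=.
by ring.
Qed.

Lemma frob_dot0l m n (X : 'M[C]_(m, n)) : frob_dot 0 X = 0.
Proof. by do 2![apply: big1 => ? _]; rewrite mxE /= !mul0r addr0. Qed.

Lemma frob_dot0r m n (X : 'M[C]_(m, n)) : frob_dot X 0 = 0.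
Proof. by do 2![apply: big1 => ? _]; rewrite mxE /= !mulr0 addr0. Qed.

(** The complex matrix obtained by giving epsilon the real value t. *)
Definition mx_at (t : R) m n (M : 'M[DC]_(m, n)) : 'M[C]_(m, n) :=
  mx_st M + t%:C *: mx_inf M.

(** The dual norms of M and N compare as the norms of M(t) and N(t) do for small
    t > 0, even when N(t) is perturbed by a term of order t^2. *)
Lemma dual_frobenius_le m n (M N : 'M[DC]_(m, n)) (Z : 'M[C]_(m, n)) (e : R) :
    0 < e ->
    (forall t, 0 < t < e ->
       frob2 (mx_at t M) <= frob2 (mx_at t N + (t ^+ 2)%:C *: Z)) ->
  dual_frobenius M <= dual_frobenius N.
Proof.
move=> e0; rewrite /mx_at => MN.
rewrite /dual_frobenius -/(dual_frob2 M) -/(dual_frob2 N).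
rewrite !dual_frob2E /complex_frobenius -/(frob2 _) -/(frob2 (mx_inf N)).
set M0 := mx_st M in MN *; set M1 := mx_inf M in MN *.
set N0 := mx_st N in MN *; set N1 := mx_inf N in MN *.
(* The coefficients of the difference of the two squared norms in t. *)
pose p := Poly [:: frob2 N0 - frob2 M0;
  2 * frob_dot N0 N1 - 2 * frob_dot M0 M1;
  frob2 N1 + 2 * frob_dot N0 Z - frob2 M1;
  2 * frob_dot N1 Z; frob2 Z].
have p_ge0 t : 0 < t < e -> 0 <= p.[t].
  move=> /MN; rewrite -[X in frob2 X <= _]addr0.
  rewrite -[X in _ + X](scaler0 _ (t ^+ 2)%:C).
  rewrite !frob2_expand !frob_dot0r -subr_ge0 horner_Poly /=.
  have -> : frob2 (0 : 'M[C]_(m, n)) = 0 by apply/eqP; rewrite frob2_eq0.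
  by congr (0 <= _); ring.
have st_le : frob2 M0 <= frob2 N0.
  have := poly_first_coef_ge0 (i := 0) e0 p_ge0.
  by rewrite coef_Poly /= subr_ge0; apply.
have inf_le : frob2 M0 = frob2 N0 -> 2 * frob_dot M0 M1 <= 2 * frob_dot N0 N1.
  move=> eq0; have := poly_first_coef_ge0 (i := 1) e0 p_ge0.
  rewrite coef_Poly /= subr_ge0; apply; case=> // _.
  by rewrite coef_Poly /= eq0 subrr.
have inf2_le : M0 = 0 -> N0 = 0 -> frob2 M1 <= frob2 N1.
  move=> M00 N00; have := poly_first_coef_ge0 (i := 2) e0 p_ge0.
  rewrite coef_Poly /= N00 frob_dot0l mulr0 addr0 subr_ge0; apply.
  by case=> [|[|//]] _; rewrite coef_Poly /= M00 N00 ?frob_dot0l subrr.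
rewrite /Order.le /= /dual_le.
case: (eqVneq M0 0) => [M00|M0n]; case: (eqVneq N0 0) => [N00|N0n] /=.
- by rewrite eqxx ler_wsqrtr ?orbT // inf2_le.
- by rewrite sqrtr_gt0 lt_def frob2_eq0 N0n frob2_ge0.
- move: st_le; rewrite leNgt N00.
  have -> : frob2 (0 : 'M[C]_(m, n)) = 0 by apply/eqP; rewrite frob2_eq0.
  by rewrite lt_def frob2_eq0 M0n frob2_ge0.
have N0pos : 0 < frob2 N0 by rewrite lt_def frob2_eq0 N0n frob2_ge0.
move: st_le; rewrite le_eqVlt => /orP[/eqP eq0|lt0].
  rewrite eq0 eqxx ler_wpM2r ?orbT ?inf_le //.
  by rewrite invr_ge0 mulr_ge0 // sqrtr_ge0.
by rewrite ltr_sqrt // lt0.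
Qed.

(** The real number obtained by giving epsilon the real value t. *)
Definition dual_at (t : R) (q : D) : R := dst q + t * dinf q.

Lemma dual_at_le (p q : D) :
  p <= q ->
  exists2 e, 0 < e & forall t, 0 < t < e -> dual_at t p <= dual_at t q.
Proof.
rewrite -[p <= q]/(dual_le p q) /dual_le.
case/orP=> [lt_pq|/andP[/eqP eq_pq le_pq]]; last first.
  exists 1 => // t /andP[t0 _].
  by rewrite /dual_at eq_pq lerD2l ler_pM2l.
pose c := `|dinf q - dinf p| + 1.
have c0 : 0 < c by rewrite ltr_wpDl.
exists ((dst q - dst p) / c); first by rewrite divr_gt0 ?subr_gt0.
move=> t /andP[t0]; rewrite ltr_pdivlMr // => tc.
rewrite /dual_at -subr_ge0.
have h : - (t * c) <= t * (dinf q - dinf p).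
  rewrite -mulrN ler_pM2l // lerNl /c.
  by rewrite (le_trans (ler_norm _)) // normrN lerDl.
by lra.
Qed.

Lemma dual_at_le_fin (I : finType) (f g : I -> D) :
  (forall i, f i <= g i) ->
  exists2 e, 0 < e &
    forall t, 0 < t < e -> forall i, dual_at t (f i) <= dual_at t (g i).
Proof.
move=> fg; have [e e0 eP] := fin_all_exists2 (fun i => dual_at_le (fg i)).
exists (\big[Num.min/1]_i e i); first by rewrite lt_bigmin.
move=> t /andP[t0 te] i; apply: eP.
by rewrite t0 (lt_le_trans te) // bigmin_le.
Qed.

Lemma mx_atB t m n (M N : 'M[DC]_(m, n)) :
  mx_at t (M - N) = mx_at t M - mx_at t N.
Proof. by rewrite /mx_at /mx_st /mx_inf !map_mxB scalerBr opprD addrACA. Qed.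

(** Giving epsilon a real value t is multiplicative up to a term in t^2 only. *)
Lemma mx_atM t m n p (X : 'M[DC]_(m, n)) (Y : 'M[DC]_(n, p)) :
  mx_at t (X *m Y) =
  mx_at t X *m mx_at t Y - (t ^+ 2)%:C *: (mx_inf X *m mx_inf Y).
Proof.
rewrite /mx_at mx_stM mx_infM mulmxDl !mulmxDr.
rewrite -!scalemxAl -!scalemxAr scalerDr !addrA.
have -> : t%:C *: (t%:C *: (mx_inf X *m mx_inf Y)) =
    (t ^+ 2)%:C *: (mx_inf X *m mx_inf Y).
  by rewrite scalerA expr2 (rmorphM (real_complex R)).
exact/esym/addrK.
Qed.

(** The perturbation of order t^2 that makes the competitor M - X Y evaluate to
    a difference with a matrix of rank at most the inner dimension. *)
Lemma mx_at_subM t m n p (M : 'M[DC]_(m, n)) (X : 'M[DC]_(m, p))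
    (Y : 'M[DC]_(p, n)) :
  mx_at t (M - X *m Y) + (t ^+ 2)%:C *: - (mx_inf X *m mx_inf Y) =
  mx_at t M - mx_at t X *m mx_at t Y.
Proof.
have cancel (G : zmodType) (a b c : G) : a - (b - c) - c = a - b.
  by rewrite opprB addrA addrAC addrK.
by rewrite mx_atB mx_atM scalerN; apply: cancel.
Qed.

Lemma mx_at_rect_diag t m n r (d : 'I_r -> D) :
  mx_at t (rect_diag m n (fun j => dual_complex (d j))) =
  rect_diag m n (fun j => (dual_at t (d j))%:C).
Proof.
have st_pid a b : mx_st (pid_mx r : 'M[DC]_(a, b)) = pid_mx r.
  exact: map_pid_mx.
have inf_pid a b : mx_inf (pid_mx r : 'M[DC]_(a, b)) = 0.
  by apply/matrixP => i j; rewrite !mxE; case: (_ && _).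
have st_diag : mx_st (diag_mx (\row_j dual_complex (d j))) =
    diag_mx (\row_j (dst (d j))%:C).
  by apply/matrixP => i j; rewrite !mxE raddfMn.
have inf_diag : mx_inf (diag_mx (\row_j dual_complex (d j))) =
    diag_mx (\row_j (dinf (d j))%:C).
  by apply/matrixP => i j; rewrite !mxE raddfMn.
rewrite /mx_at /rect_diag !(mx_stM, mx_infM) !st_pid !inf_pid st_diag inf_diag.
rewrite !(mulmx0, mul0mx, addr0, add0r) -!/(rect_diag _ _ _).
rewrite rect_diagZ rect_diagD.
by apply: eq_rect_diag => j; rewrite /dual_at rmorphD rmorphM.
Qed.

(** Eckart-Young theorem for a rectangular diagonal matrix of dual numbers;
    the competitors are the products with inner dimension s <= k. *)
Lemma eckart_young_dual_rect_diag m n r k s (hm : (r <= m)%N) (hn : (r <= n)%N)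
    (mu : 'I_r -> D) (X : 'M[DC]_(m, s)) (Y : 'M[DC]_(s, n)) :
    (k <= r)%N -> (s <= k)%N -> (forall j, 0 <= mu j) ->
    (forall i j : 'I_r, (i <= j)%N -> mu j <= mu i) ->
  dual_frobenius (rect_diag m n (fun j => dual_complex (tail k mu j))) <=
  dual_frobenius (rect_diag m n (fun j => dual_complex (mu j)) - X *m Y).
Proof.
move=> kr sk mu0 muS.
have [e1 e10 at_ge0] : exists2 e : R, 0 < e &
    forall t, 0 < t < e -> forall j, dual_at t 0 <= dual_at t (mu j).
  exact: dual_at_le_fin.
(* Pairs with ij.1 > ij.2 carry a trivial inequality, so that the family of all
   pairs satisfies the hypothesis of the lemma. *)
have [e2 e20 at_le] : exists2 e : R, 0 < e & forall t, 0 < t < e ->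
    forall ij : 'I_r * 'I_r,
      dual_at t (if (ij.1 <= ij.2)%N then mu ij.2 else mu ij.1) <=
      dual_at t (mu ij.1).
  by apply: dual_at_le_fin => -[i j] /=; case: ifPn => // /muS.
apply: (@dual_frobenius_le _ _ _ _ (- (mx_inf X *m mx_inf Y)) (Num.min e1 e2)).
  by rewrite lt_min e10 e20.
move=> t /andP[t0]; rewrite lt_min => /andP[te1 te2].
rewrite mx_at_subM [in leLHS]mx_at_rect_diag [in leRHS]mx_at_rect_diag.
rewrite -lecR !frob2C.
have -> : rect_diag m n (fun j => (dual_at t (tail k mu j))%:C) =
    rect_diag m n (tail k (fun j => (dual_at t (mu j))%:C)).
  apply: eq_rect_diag => j; rewrite /tail; case: (k <= j)%N => //.
  by rewrite !mulr0n /dual_at /= mulr0 addr0.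
apply: eckart_young_rect_diag => // [j|i j ij|].
- rewrite lecR; have := at_ge0 t.
  by rewrite t0 te1 {1}/dual_at /= mulr0 addr0; apply.
- rewrite lecR; have := at_le t.
  by rewrite t0 te2 => /(_ isT (i, j)) /=; rewrite ij.
by rewrite (leq_trans (mulmx_max_rank _ _)).
Qed.

End Germs.

(** * Singular value decompositions *)

Section SingularValueDecomposition.
Variable R : realType.
Local Notation C := R[i].
Local Notation D := (dual_num R).
Local Notation DC := (dual_num C).

Lemma sing_mxE m n r (hm : (r <= m)%N) (hn : (r <= n)%N) (mu : 'I_r -> D) :
  sing_mx hm hn mu = rect_diag m n (fun j => dual_complex (mu j)).
Proof.
by rewrite /sing_mx -(castmx_rect_diag (subnKC hm) (subnKC hn)) rect_diag_block.
Qed.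

Lemma is_svdE m n r (hm : (r <= m)%N) (hn : (r <= n)%N)
    (A : 'M[DC]_(m, n)) U V (mu : 'I_r -> D) :
  is_svd hm hn A U V mu ->
  A = U *m rect_diag m n (fun j => dual_complex (mu j)) *m dual_adjoint V.
Proof.
case=> /mulmx1C UU /mulmx1C VV _ _; rewrite sing_mxE => <-.
by rewrite !mulmxA UU mul1mx -mulmxA VV mulmx1.
Qed.

Lemma svd_truncE m n r (hm : (r <= m)%N) (hn : (r <= n)%N)
    (U : 'M[DC]_m) (V : 'M[DC]_n) (mu : 'I_r -> D) k :
  svd_trunc hm hn U V mu k =
  U *m rect_diag m n (fun j => dual_complex (mu j) *+ (j < k)%N) *m
  dual_adjoint V.
Proof.
rewrite /rect_diag !mulmxA (pid_mx_colsub _ hm) mulmx_colsub mulmx1.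
rewrite (pid_mxErow _ hn) -mulmxA mul_rowsub_mx mul1mx mul_mx_diag.
apply/matrixP => i l; rewrite summxE mxE big_mkcond; apply: eq_bigr => j _.
rewrite !mxE; case: (j < k)%N; last by rewrite mulr0n mulr0 mul0r.
by rewrite big_ord1 !mxE mulr1n mulrCA mulrA.
Qed.

Lemma unitary_cancel m n (U : 'M[DC]_m) (V : 'M[DC]_n) (X : 'M[DC]_(m, n)) :
  dual_unitary U -> dual_unitary V ->
  dual_adjoint U *m (U *m X *m dual_adjoint V) *m V = X.
Proof.
rewrite /dual_unitary => hU hV.
by rewrite !mulmxA hU mul1mx -mulmxA hV mulmx1.
Qed.

Lemma has_rank_factor m n s (B : 'M[DC]_(m, n)) :
  has_rank B s ->
  exists (X : 'M[DC]_(m, s)) (Y : 'M[DC]_(s, n)), B = X *m Y.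
Proof.
case=> [hm [hn [U [V [mu /is_svdE ->]]]]].
exists (U *m (pid_mx s *m diag_mx (\row_j dual_complex (mu j)))),
       (pid_mx s *m dual_adjoint V).
by rewrite /rect_diag !mulmxA.
Qed.

End SingularValueDecomposition.

Theorem theorem7p1 (R : realType) (m n r k : nat)
  (hm : (r <= m)%N) (hn : (r <= n)%N)
  (A : 'M[dual_num R[i]]_(m, n))
  (U : 'M[dual_num R[i]]_m) (V : 'M[dual_num R[i]]_n)
  (mu : 'I_r -> dual_num R)
  (hA : is_svd hm hn A U V mu)
  (hk : (k <= r)%N)
  (B : 'M[dual_num R[i]]_(m, n))
  (hB : exists2 s : nat, has_rank B s & (s <= k)%N) :
  dual_frobenius (A - svd_trunc hm hn U V mu k) <= dual_frobenius (A - B).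
Proof.
have [hU hV mu0 muS _] := hA; case: hB => s /has_rank_factor[X [Y BE]] sk.
have truncE : dual_adjoint U *m (A - svd_trunc hm hn U V mu k) *m V =
    rect_diag m n (fun j => dual_complex (tail k mu j)).
  rewrite (is_svdE hA) svd_truncE -mulmxBl -mulmxBr unitary_cancel //.
  apply/eqP; rewrite subr_eq rect_diagD; apply/eqP; apply: eq_rect_diag => j.
  rewrite /tail raddfMn ltnNge.
  by case: (k <= j)%N; rewrite ?mulr0n ?mulr1n ?addr0 ?add0r.
have diffE : dual_adjoint U *m (A - B) *m V =
    rect_diag m n (fun j => dual_complex (mu j)) -
    (dual_adjoint U *m X) *m (Y *m V).
  rewrite mulmxBr mulmxBl {1}(is_svdE hA) unitary_cancel // BE.
  by rewrite !mulmxA.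
rewrite -[leLHS](dual_frobenius_unitary _ hU hV) [in leLHS]truncE.
rewrite -[leRHS](dual_frobenius_unitary _ hU hV) [in leRHS]diffE.
by apply: eckart_young_dual_rect_diag => // j; apply: ltW.
Qed.
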